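(* Let Assumptions A1–A5 (stated in the context) hold and let $\{x_k\}$ be a sequence generated by Algorithm IR-NS. If $\sum_{k=0}^{\infty}\alpha_k=\infty$ and $\sum_{k=0}^{\infty}t_k<\infty$, where $t_k$ is the SAA error defined in the context, then there exists an accumulation point $x^*$ of $\{x_k\}$ which is a solution of the problem $\min_{x\in\mathbb{R}^n} f(x)$.
   Context: Problem: $\min_{x\in\mathbb{R}^n} f(x)=E[F(x,\xi)]$, where $F:\mathbb{R}^n\times\mathbb{R}^m\to\mathbb{R}$ is continuous and convex in $x$ and bounded from below, $\xi:\Omega\to\mathbb{R}^m$ is a random vector on a probability space $(\Omega,\mathcal{F},P)$. For an i.i.d. sample $\xi_1,\dots,\xi_N$ of $\xi$, the sample average approximation (SAA) is $f_N(x)=\frac1N\sum_{i=1}^N f_i(x)$, $f_i(x)=F(x,\xi_i)$. $\partial f_N(x)$ is the convex subdifferential. The function $h:\mathbb{N}\to[0,\infty)$ is a fixed monotonically decreasing function with $\lim_{N\to\infty}h(N)=0$. The merit function is $\Phi(x,N,\theta)=\theta f_N(x)+(1-\theta)h(N)$, $\theta\in(0,1)$. Algorithm IR-NS. S0: Given $x_0\in\mathbb{R}^n$, $N_0\in\mathbb{N}$, $\theta_0,r\in(0,1)$, $\beta,\gamma,\overline{\gamma}>0$. Set $k=0$. S1: Find $\tilde N_{k+1}\ge N_k$ such that $h(\tilde N_{k+1})\le r\,h(N_k)$ and (R) $f_{\tilde N_{k+1}}(x_k)-f_{N_k}(x_k)\le\beta h(N_k)$. S2: If $\Phi(x_k,\tilde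 N_{k+1},\theta_k)-\Phi(x_k,N_k,\theta_k)\le\frac{1-r}{2}\big(h(\tilde N_{k+1})-h(N_k)\big)$ set $\theta_{k+1}=\theta_k$; else $\theta_{k+1}=\frac{(1+r)(h(N_k)-h(\tilde N_{k+1}))}{2[f_{\tilde N_{k+1}}(x_k)-f_{N_k}(x_k)+h(N_k)-h(\tilde N_{k+1})]}$. S3: Choose $N_{k+1}\le\tilde N_{k+1}$, a direction $p_{N_{k+1}}(x_k)\in\mathbb{R}^n$ (of the type in Assumption A2) and $\alpha_k\in(0,1]$ such that (i) $f_{N_{k+1}}(x_k+\alpha_kp_{N_{k+1}}(x_k))-f_{\tilde N_{k+1}}(x_k)\le-\gamma\alpha_k\|p_{N_{k+1}}(x_k)\|^2$, (ii) $h(N_{k+1})\le h(\tilde N_{k+1})+\overline{\gamma}\alpha_k^2\|p_{N_{k+1}}(x_k)\|^2$, (iii) $\Phi(x_k+\alpha_kp_{N_{k+1}}(x_k),N_{k+1},\theta_{k+1})-\Phi(x_k,N_k,\theta_{k+1})\le\frac{1-r}{2}\big(h(\tilde N_{k+1})-h(N_k)\big)$. S4: Set $p_k=p_{N_{k+1}}(x_k)$, $x_{k+1}=x_k+\alpha_kp_k$, $k:=k+1$, go to S1. Sampling: the SAA functions use i.i.d. samples. In S1 a random sample is generated for $f_{\tilde N_{k+1}}$; in S3 the sample for $f_{N_{k+1}}$ may differ from it. With $\mathcal{F}_k$ the $\sigma$-algebra generated by $x_0,\dots,x_k$, one has $E[f_{\tilde N_{k+1}}(x_k)\mid\mathcal{F}_k]=f(x_k)$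 and $E[f_{N_{k+1}}(x_k)\mid\mathcal{F}_k]=f(x_k)$. Assumptions. A1: the functions $f_i(x)=F(x,\xi_i)$, $i=1,2,\dots$, are continuous, convex and bounded from below by a constant $C$ for all $\xi_i$. A2: for any given $N$, $x$ and $B$ such that $mI\preceq B(x)\preceq MI$, for some positive bounded constants $m\le M$, one can compute a direction $p_N(x)\in\mathbb{R}^n$ such that $p_N(x)=-B(x)\bar g_N(x)$ and $\sup_{g\in\partial f_N(x)}g^Tp_N(x)\le-\frac m2\|\bar g_N(x)\|^2$, where $\bar g_N(x)\in\partial f_N(x)$. A3: there exists $\beta$ such that (R) holds for each $k$. A4: $f$ has bounded level sets. A5: $F$ is dominated by an integrable function on a bounded open set $\tilde D^0$ with $D\subset\tilde D^0$. Here $D=\{x\in\mathbb{R}^n: f(x)\le C_2\}$, $C_2=C_0+2\beta C_1$, where $C_0$ is a constant with $F(x_0,\xi)\le C_0$ for any $\xi$ (assumed to exist) and $C_1>0$ is a constant with $\sum_{k=0}^\infty h(N_k)\le C_1<\infty$ (such a constant exists for Algorithm IR-NS by a known result). SAA error: $t_k=\max_{x,y\in\tilde D}\{|f(x)-f_{N_{k+1}}(x)|+|f(y)-f_{\tilde N_{k+1}}(y)|\}$, where $\tilde D$ is the closure of $\tilde D^0$ (so $\tilde D$ is compact and $D\subsetneq\tilde D$). *)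

(* Defs.v *)
From HB Require Import structures.
From mathcomp Require Import all_boot all_order all_algebra.
From mathcomp Require Import all_classical all_reals all_analysis.
From mathcomp Require Import measurable_realfun.
Import Order.TTheory GRing.Theory Num.Theory.
Import numFieldNormedType.Exports.
Set Implicit Arguments.
Unset Strict Implicit.
Unset Printing Implicit Defensive.
Local Open Scope classical_set_scope.
Local Open Scope ring_scope.

(* The library norm on matrices is the maximum norm.  It induces the usual
   topology of R^n, but every norm of the algorithm is Euclidean, and enters
   only through its square [dotv v v]. *)
Definition dotv (R : realType) (n : nat) (u v : 'cV[R]_n) : R :=
  (u^T *m v) ord0 ord0.

Definition subdifferential (R : realType) (n : nat) (phi : 'cV[R]_n -> R)
    (x : 'cV[R]_n) : set 'cV[R]_n :=
  [set g | forall y, phi x + dotv g (y - x) <= phi y].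

(* a I <= B <= b I in the Loewner order of symmetric matrices *)
Definition loewner_between (R : realType) (n : nat) (a b : R)
    (B : 'M[R]_n) : Prop :=
  B^T = B /\ forall v, a * dotv v v <= dotv v (B *m v) <= b * dotv v v.

(* p = - B gbar with gbar in the subdifferential of phi at x, and
   sup_(g in subdifferential phi x) g^T p <= - (a / 2) |gbar|^2. *)
Definition descent_direction (R : realType) (n : nat) (a : R) (B : 'M[R]_n)
    (phi : 'cV[R]_n -> R) (x p : 'cV[R]_n) : Prop :=
  exists gbar : 'cV[R]_n,
    [/\ subdifferential phi x gbar,
        p = - (B *m gbar) &
        (ereal_sup [set (dotv g p)%:E | g in subdifferential phi x]
          <= (- (a / 2) * dotv gbar gbar)%:E)%E].

(* Borel sets; the library has no canonical measurable structure on matrices. *)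
Definition borel (T : topologicalType) : set (set T) := <<s [set U | open U] >>.

Definition random_vector d (Omega : measurableType d) (R : realType) (m : nat)
    (X : Omega -> 'cV[R]_m) : Prop :=
  forall B, borel B -> measurable (X @^-1` B).

Definition borel_fun (R : realType) (m : nat) (g : 'cV[R]_m -> R) : Prop :=
  forall B : set R, borel B -> borel (g @^-1` B).

(* (z i)_i are mutually independent random vectors distributed as xi. *)
Definition iid_sample d (Omega : measurableType d) (R : realType)
    (P : probability Omega R) (m : nat) (xi : Omega -> 'cV[R]_m)
    (z : nat -> Omega -> 'cV[R]_m) : Prop :=
  [/\ forall i, random_vector (z i),
      forall i B, borel B -> P (z i @^-1` B) = P (xi @^-1` B) &
      forall (J : seq nat) (B : nat -> set 'cV[R]_m), uniq J ->
        (forall j, borel (B j)) ->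
        P (\bigcap_(j in [set` J]) (z j @^-1` B j)) =
        (\prod_(j <- J) P (z j @^-1` B j))%E].

(* The sigma-algebra generated by x_0, ..., x_k. *)
Definition sigma_gen (Omega : Type) (R : realType) (n : nat)
    (x : nat -> Omega -> 'cV[R]_n) (k : nat) : set (set Omega) :=
  <<s [set A | exists j B, [/\ (j <= k)%N, borel B & A = x j @^-1` B]] >>.

(* Y is a version of the conditional expectation E[X | G], G being a
   sub-sigma-algebra of that of Omega. *)
Definition is_cond_expectation d (Omega : measurableType d) (R : realType)
    (P : probability Omega R) (G : set (set Omega))
    (X Y : Omega -> \bar R) : Prop :=
  [/\ P.-integrable setT X,
      P.-integrable setT Y,
      forall B : set (\bar R), measurable B -> G (Y @^-1` B) &
      forall A, G A -> (\int[P]_(w in A) Y w = \int[P]_(w in A) X w)%E].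

(* f(x) = E[F(x, xi)].  It is extended-real valued: its finiteness is not
   postulated, but follows from the domination assumption where needed. *)
Definition objective d (Omega : measurableType d) (R : realType)
    (P : probability Omega R) (n m : nat) (F : 'cV[R]_n -> 'cV[R]_m -> R)
    (xi : Omega -> 'cV[R]_m) (x : 'cV[R]_n) : \bar R :=
  ('E_P[fun w => F x (xi w)])%E.

(* f_N(x) for the sample z_0, ..., z_(N-1); meaningful for 0 < N. *)
Definition saa (R : realType) (n m : nat) (F : 'cV[R]_n -> 'cV[R]_m -> R)
    (N : nat) (z : nat -> 'cV[R]_m) (x : 'cV[R]_n) : R :=
  N%:R^-1 * \sum_(i < N) F x (z i).

(* Phi(x, N, theta), where fN is the SAA function of sample size N. *)
Definition merit (R : realType) (n : nat) (h : nat -> R)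
    (fN : 'cV[R]_n -> R) (x : 'cV[R]_n) (N : nat) (theta : R) : R :=
  theta * fN x + (1 - theta) * h N.

(* Condition (R); the sample sizes and functions are (N, fN) and (Nt, ftN). *)
Definition condR (R : realType) (n : nat) (h : nat -> R) (beta : R)
    (fN ftN : 'cV[R]_n -> R) (N : nat) (x : 'cV[R]_n) : Prop :=
  ftN x - fN x <= beta * h N.

Definition theta_update (R : realType) (n : nat) (h : nat -> R) (r : R)
    (fN ftN : 'cV[R]_n -> R) (N Nt : nat) (x : 'cV[R]_n) (theta : R) : R :=
  if merit h ftN x Nt theta - merit h fN x N theta
       <= (1 - r) / 2 * (h Nt - h N)
  then theta
  else ((1 + r) * (h N - h Nt)) / (2 * (ftN x - fN x + h N - h Nt)).

(* One realization of Algorithm IR-NS.  [N k], [Nt k.+1] are the sample sizes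
   N_k, Ntilde_(k+1), and [fN k], [ftN k.+1] the SAA functions formed from the
   samples drawn for them ([Nt 0] and [ftN 0] are not used).  Sample sizes are
   positive integers. *)
Record IR_NS (R : realType) (n : nat) (h : nat -> R)
    (x0 : 'cV[R]_n) (N0 : nat) (theta0 r beta gamma gammabar a b : R)
    (fN ftN : nat -> 'cV[R]_n -> R) (N Nt : nat -> nat)
    (theta alpha : nat -> R) (x p : nat -> 'cV[R]_n) : Prop := {
  S0 : [/\ x 0%N = x0, N 0%N = N0 & theta 0%N = theta0] ;
  S1 : forall k,
    [/\ (N k <= Nt k.+1)%N,
        h (Nt k.+1) <= r * h (N k) &
        condR h beta (fN k) (ftN k.+1) (N k) (x k)] ;
  S2 : forall k,
    theta k.+1 =
      theta_update h r (fN k) (ftN k.+1) (N k) (Nt k.+1) (x k) (theta k) ;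
  S3_choice : forall k,
    [/\ (0 < N k.+1 <= Nt k.+1)%N,
        exists2 B, loewner_between a b B &
          descent_direction a B (fN k.+1) (x k) (p k) &
        0 < alpha k <= 1] ;
  S3_i : forall k,
    fN k.+1 (x k + alpha k *: p k) - ftN k.+1 (x k)
      <= - gamma * alpha k * dotv (p k) (p k) ;
  S3_ii : forall k,
    h (N k.+1)
      <= h (Nt k.+1) + gammabar * alpha k ^+ 2 * dotv (p k) (p k) ;
  S3_iii : forall k,
    merit h (fN k.+1) (x k + alpha k *: p k) (N k.+1) (theta k.+1)
      - merit h (fN k) (x k) (N k) (theta k.+1)
      <= (1 - r) / 2 * (h (Nt k.+1) - h (N k)) ;
  S4 : forall k, x k.+1 = x k + alpha k *: p k
}.

Definition assumption_A1 (R : realType) (n m : nat)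
    (F : 'cV[R]_n -> 'cV[R]_m -> R) (C : R) : Prop :=
  forall z, [/\ continuous (F ^~ z),
                convex_function [set: 'cV[R]_n] (F ^~ z) &
                forall x, C <= F x z].

Definition assumption_A2 (R : realType) (n m : nat)
    (F : 'cV[R]_n -> 'cV[R]_m -> R) (a b : R) : Prop :=
  forall (N : nat) (z : nat -> 'cV[R]_m) (x : 'cV[R]_n) (B : 'M[R]_n),
    (0 < N)%N -> loewner_between a b B ->
    exists p, descent_direction a B (saa F N z) x p.

Definition bounded_level_sets (R : realType) (n : nat)
    (f : 'cV[R]_n -> \bar R) : Prop :=
  forall c : R, bounded_set [set x | (f x <= c%:E)%E].

Definition dominated_on d (Omega : measurableType d) (R : realType)
    (P : probability Omega R) (n m : nat) (F : 'cV[R]_n -> 'cV[R]_m -> R)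
    (xi : Omega -> 'cV[R]_m) (D0 : set 'cV[R]_n) : Prop :=
  exists2 g : 'cV[R]_m -> R,
    P.-integrable setT (fun w => (g (xi w))%:E) &
    {ae P, forall w, forall x, D0 x -> `|F x (xi w)| <= g (xi w)}.

(* max over x, y in Dt of |f(x) - f_N(x)| + |f(y) - f_Nt(y)| *)
Definition saa_error (R : realType) (n : nat) (f : 'cV[R]_n -> \bar R)
    (Dt : set 'cV[R]_n) (fN ftN : 'cV[R]_n -> R) : \bar R :=
  ereal_sup [set (`|f u.1 - (fN u.1)%:E| + `|f u.2 - (ftN u.2)%:E|)%E
            | u in Dt `*` Dt].

(* Main.v *)
(* Taking conditional expectations in f_Ntilde_(k+1)(x_k) <= C_0 + beta C_1,
   which follows from (R) and (i), shows that almost surely every x_k lies in D.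
   On such a path, (i) gives
   f(x_(k+1)) <= f(x_k) + t_k - gamma alpha_k |p_k|^2; since sum t_k is finite,
   sum alpha_k infinite and f is bounded below on the path, liminf |p_k| = 0.
   As |gbar_k| <= |p_k| / a (a being the paper's m), the subgradient inequality
   at x_k along a subsequence with p_k -> 0, together with t_k -> 0, shows that
   a cluster point of that subsequence minimizes f over the compact closure of
   D0.  Outside of it f exceeds C_2 >= f(x_0). *)
Require Import Defs.
From HB Require Import structures.
From mathcomp Require Import all_boot all_order all_algebra.
From mathcomp Require Import all_classical all_reals all_analysis.
From mathcomp Require Import measurable_realfun.
From mathcomp Require Import ring lra.
Import Order.TTheory GRing.Theory Num.Theory.
Import numFieldNormedType.Exports.
Local Open Scope classical_set_scope.
Local Open Scope ring_scope.
Set Implicit Arguments.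
Unset Strict Implicit.
Unset Printing Implicit Defensive.

(** * Euclidean products and compactness for column vectors *)

Lemma dotvE (R : realType) (n : nat) (u v : 'cV[R]_n) :
  dotv u v = \sum_i u i ord0 * v i ord0.
Proof. by rewrite /dotv mxE; apply: eq_bigr => i _; rewrite mxE. Qed.

Lemma dotv_ge0 (R : realType) (n : nat) (u : 'cV[R]_n) : 0 <= dotv u u.
Proof. by rewrite dotvE sumr_ge0// => i _; rewrite -expr2 sqr_ge0. Qed.

Lemma dotvN (R : realType) (n : nat) (u v : 'cV[R]_n) :
  dotv u (- v) = - dotv u v.
Proof. by rewrite /dotv mulmxN mxE. Qed.

(** This is the square of [s *: u + v] expanded. It plays the part of Cauchy-Schwarz while keeping
    Euclidean lengths squared. *)
Lemma dotv_young (R : realType) (n : nat) (s : R) (u v : 'cV[R]_n) :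
  0 <= s ^+ 2 * dotv u u + 2 * s * dotv u v + dotv v v.
Proof.
have := dotv_ge0 (s *: u + v); rewrite !dotvE !mulr_sumr -!big_split /=.
congr (0 <= _); apply: eq_bigr => i _; rewrite !mxE; ring.
Qed.

Lemma continuous_sqdist (R : realType) (n : nat) (y : 'cV[R]_n) :
  continuous (fun u : 'cV[R]_n => dotv (y - u) (y - u)).
Proof.
rewrite (_ : (fun u : 'cV[R]_n => dotv (y - u) (y - u)) =
   (fun u : 'cV[R]_n => \sum_i (y i ord0 - u i ord0) * (y i ord0 - u i ord0)));
  last by apply/funext => v; rewrite dotvE; apply: eq_bigr => i _; rewrite !mxE.
apply: continuous_big => [|i _ u]; first exact: add_continuous.
have h : (y i ord0 - v i ord0) @[v --> u] --> y i ord0 - u i ord0.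
  by apply: cvgB; [exact: cvg_cst|exact: coord_continuous].
exact: (cvgM h h).
Qed.

Lemma normr_trmx (R : realType) (m n : nat) (u : 'M[R]_(m, n)) :
  `|u^T| = `|u|.
Proof.
suff le_trmx k l (v : 'M[R]_(k, l)) : `|v^T| <= `|v|.
  by apply/eqP; rewrite eq_le le_trmx -{1}[u]trmxK le_trmx.
rewrite [leLHS]/Num.norm/= mx_normrE; apply/bigmax_leP; split=> // -[i j] _ /=.
rewrite mxE [leRHS]/Num.norm/= mx_normrE; apply/bigmax_geP; right.
by exists (j, i).
Qed.

Lemma trmx_continuous (R : realType) (m n : nat) : continuous (@trmx R m n).
Proof.
move=> u A /nbhs_ballP[e e0 uA]; apply/nbhs_ballP; exists e => // v [_ uv].
by apply: uA; split=> // i j; rewrite !mxE; exact: uv.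
Qed.

(** Heine-Borel is carried over from row vectors by transposition, a continuous involution that
    preserves the norm. *)
Lemma bounded_closed_compact_cV (R : realType) (n : nat) (A : set 'cV[R]_n) :
  bounded_set A -> closed A -> compact A.
Proof.
move=> bA cA.
have -> : A = (@trmx R 1 n) @` ((@trmx R 1 n) @^-1` A).
  apply/seteqP; split=> [v Av|_ [v ? <-]//].
  by exists v^T; rewrite /= trmxK.
apply: continuous_compact.
  by apply: continuous_subspaceT; exact: trmx_continuous.
apply: bounded_closed_compact; last first.
  by apply: preimage_closed => // u _; exact: trmx_continuous.
case: bA => M [Mr MA]; exists M; split=> // K MK v /= Av.
by rewrite -normr_trmx; exact: MA Av.
Qed.

Lemma bounded_closure (R : realType) (V : normedModType R) (A : set V) :
  bounded_set A -> bounded_set (closure A).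
Proof.
move=> [M [Mr MA]]; exists M; split=> // e Me.
have cle : closed [set v : V | `|v| <= e].
  have : closed [set t : R | t <= e] by exact: closed_le.
  by apply: preimage_closed => v _; exact: norm_continuous.
by move=> v /(closureS (MA e Me)) /cle.
Qed.

(** * Almost sure upper bounds under conditional expectation *)

Lemma cond_expectation_le d (Omega : measurableType d) (R : realType)
    (P : probability Omega R) (G : set (set Omega)) (X Y : Omega -> \bar R)
    (c : R) :
  is_cond_expectation P G X Y -> {ae P, forall w, (X w <= c%:E)%E} ->
  {ae P, forall w, (Y w <= c%:E)%E}.
Proof.
move=> [iX iY YG YX] Xc.
(* On [A], which lies in [G], the integral of [Y - c] equals that of [X - c], hence is at most 0,
   while [Y - c] is positive there. So [Y - c] vanishes almost everywhere on [A], which [Y > c]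
   forbids. *)
pose A := Y @^-1` [set y | (c%:E < y)%E].
have mB : measurable [set y | (c%:E < y)%E].
  rewrite (_ : mkset _ = [set` `]c%:E, +oo[]); first exact: emeasurable_itv.
  by apply/seteqP; split=> y /=; rewrite in_itv/= andbT.
have GA : G A := YG _ mB.
have mA : measurable A.
  by rewrite -[A]setTI; apply: (measurable_int _ iY).
have iXA : P.-integrable A X by apply: integrableS iX.
have iYA : P.-integrable A Y by apply: integrableS iY.
have icA : P.-integrable A (cst c%:E) by apply: finite_measure_integrable_cst.
have iYc : P.-integrable A (Y \- cst c%:E)%E by apply: integrableB.
have icX : P.-integrable A (cst c%:E \- X)%E by apply: integrableB.
have cX0 : (0 <= \int[P]_(w in A) (cst c%:E \- X) w)%E.
  (* [X <= c] holds only almost everywhere, so [c - X] is exchanged for its positive part,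
     nonnegative everywhere. *)
  rewrite (ae_eq_integral (fun w => maxe ((cst c%:E \- X) w) 0)%E) //.
  - by apply: integral_ge0 => w _; rewrite le_max lexx orbT.
  - exact: measurable_int icX.
  - by apply: measurable_maxe => //; exact: measurable_int icX.
  - apply: filterS Xc => w /= Xw _; rewrite max_l//.
    by move: Xw; rewrite -sube_le0 -oppe_ge0; case: (X w) => [x||] //;
      rewrite -?EFinN -!EFinD !lee_fin opprB.
have Yc0 : (\int[P]_(w in A) (Y \- cst c%:E) w <= 0)%E.
  rewrite integralB// YX// sube_le0 -suber_ge0 -?integralB//.
  exact: integrable_fin_num.
have Y0 : ae_eq P A (Y \- cst c%:E)%E (cst 0%E).
  apply/ae_eq_integral_abs => //; first exact: measurable_int iYc.
  apply/eqP; rewrite eq_le integral_ge0// andbT.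
  rewrite (eq_integral (Y \- cst c%:E)%E)// => w.
  rewrite inE /A /= => cY; by apply: gee0_abs; rewrite EFinN suber_ge0 ?ltW.
apply: filterS Y0 => w /= h; rewrite leNgt; apply/negP => cY.
by have := h cY; move: cY; rewrite -sube_gt0 => /[swap] ->; rewrite ltxx.
Qed.

(** * Cluster points of sequences and terms of bounded series *)

Lemma cluster_subsequence (T : topologicalType) (u : nat -> T)
    (phi : nat -> nat) (l : T) :
  (forall j, (j <= phi j)%N) -> cluster (u \o phi @ \oo) l ->
  cluster (u @ \oo) l.
Proof.
(* [phi] need not be monotone: by [j <= phi j], a set containing a tail of [u] contains a tail of
   [u \o phi]. *)
move=> le_phi cl A B [M _ MA]; apply: cl; exists M => // j Mj.
by apply: MA; exact: leq_trans (le_phi j).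
Qed.

Lemma cluster_frequently (T : topologicalType) (u : nat -> T) (l : T)
    (U : set T) (M : nat) :
  cluster (u @ \oo) l -> nbhs l U -> exists2 k, (M <= k)%N & U (u k).
Proof.
move=> cl lU; have [] := cl (u @` [set k | (M <= k)%N]) U.
- by exists M => // k Mk; exists k.
- exact: lU.
- by move=> _ [[k Mk <-] Uk]; exists k.
Qed.

Lemma bounded_series_terms_small (R : realType) (T : nat -> R) (M : R) :
  (forall k, 0 <= T k) -> (forall k, \sum_(0 <= i < k) T i <= M) ->
  forall e, 0 < e -> exists K, forall k, (K <= k)%N -> T k < e.
Proof.
move=> T0 TM e e0.
have : cvgn (series T).
  apply: nondecreasing_is_cvgn.
    by apply/nondecreasing_seqP => k; rewrite /series/= big_nat_recr//= lerDl.
  by exists M => _ [k _ <-]; exact: TM.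
move=> /cvg_series_cvg_0/cvgr0_norm_lt/(_ e e0)[K _ KT].
by exists K => k /KT/=; rewrite ger0_norm.
Qed.

(** * Convergence along a single path *)

Section deterministic_convergence.
Context (R : realType) (n : nat) (K : set 'cV[R]_n) (fr : 'cV[R]_n -> R).
Context (fk ftk : nat -> 'cV[R]_n -> R) (x p g : nat -> 'cV[R]_n).
Context (alpha T : nat -> R) (gamma c C M : R).
Hypothesis gamma_gt0 : 0 < gamma.
Hypothesis c_gt0 : 0 < c.
Hypothesis compactK : compact K.
Hypothesis Kx : forall k, K (x k).
Hypothesis error : forall k u v, K u -> K v ->
  `|fr u - fk k u| + `|fr v - ftk k v| <= T k.
Hypothesis T_bounded : forall k, \sum_(0 <= i < k) T i <= M.
Hypothesis alpha_ge0 : forall k, 0 <= alpha k.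
Hypothesis alpha_unbounded : forall A, exists k, A < \sum_(0 <= i < k) alpha i.
Hypothesis fk_continuous : forall k, continuous (fk k).
Hypothesis fk_ge : forall k u, C <= fk k u.
Hypothesis g_subgrad : forall k, subdifferential (fk k) (x k) (g k).
Hypothesis g_le : forall k, dotv (g k) (g k) <= c * dotv (p k) (p k).
Hypothesis descent : forall k,
  fk k (x k.+1) - ftk k (x k) <= - gamma * alpha k * dotv (p k) (p k).

Lemma error_ge0 k : 0 <= T k.
Proof. by apply: le_trans (error k (Kx 0) (Kx 0)); rewrite addr_ge0. Qed.

Lemma error_le k u : K u -> `|fr u - fk k u| <= T k.
Proof. by move=> Ku; apply: le_trans (error k Ku Ku); rewrite lerDl. Qed.

(** [descent] is read in terms of [fr]. Both replacements, at [x k.+1] and at [x k], cost one [T k]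
    together, since [error] bounds the sum of the two deviations. *)
Lemma objective_descent k :
  fr (x k.+1) <= fr (x k) + T k - gamma * alpha k * dotv (p k) (p k).
Proof.
have := error k (Kx k.+1) (Kx k); have := descent k.
have := ler_norm (fr (x k.+1) - fk k (x k.+1)).
have := ler_norm (- (fr (x k) - ftk k (x k))); rewrite normrN; lra.
Qed.

(* If [p] stayed away from 0, the divergent sum of the steps would push [fr]
   below its lower bound. *)
Lemma direction_small e J : 0 < e ->
  exists2 k, (J <= k)%N & dotv (p k) (p k) < e.
Proof.
move=> e0; apply: contrapT => /forall2NP nex.
have pe k : (J <= k)%N -> e <= dotv (p k) (p k).
  by move=> Jk; have [//|] := nex k; move=> /negP; rewrite leNgt.
(* The sum of [T] starts at 0 instead of [J]: this only weakens the bound and lets [T_bounded] apply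
   directly. *)
have tele k : fr (x (J + k)%N) <= fr (x J) +
    \sum_(0 <= i < J + k) T i - gamma * e * (\sum_(0 <= i < J + k) alpha i
      - \sum_(0 <= i < J) alpha i).
  elim: k => [|k IH].
    rewrite addn0 subrr mulr0 subr0 lerDl sumr_ge0// => i _.
    exact: error_ge0.
  rewrite addnS !big_nat_recr//=.
  have := objective_descent (J + k).
  have : gamma * e * alpha (J + k)%N <=
      gamma * alpha (J + k)%N * dotv (p (J + k)) (p (J + k)).
    rewrite mulrAC ler_wpM2l// ?pe ?leq_addr// mulr_ge0//; exact: ltW.
  by move: IH; lra.
have ge0 : 0 < gamma * e by rewrite mulr_gt0.
have T_le k : T k <= M.
  apply: le_trans (T_bounded k.+1); rewrite big_nat_recr//= lerDr.
  by rewrite sumr_ge0// => i _; exact: error_ge0.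
(* Beyond [B], [tele] pushes [fr] below [C - M], whereas [fk_ge] and [error_le] keep it above. One
   [M] pays for the summed errors, the other for the error at the last iterate. *)
pose B := (fr (x J) + M + M - C) / (gamma * e) + \sum_(0 <= i < J) alpha i.
have [k Bk] := alpha_unbounded B.
have Bk' : B < \sum_(0 <= i < J + k) alpha i.
  apply: (lt_le_trans Bk).
  rewrite addnC (@big_cat_nat _ _ _ k 0 (k + J))//= ?leq_addr//.
  by rewrite lerDl sumr_ge0.
have : fr (x J) + M + M - C < gamma * e *
    (\sum_(0 <= i < J + k) alpha i - \sum_(0 <= i < J) alpha i).
  by rewrite mulrC -ltr_pdivrMr// ltrBrDr.
have := tele k; have := T_bounded (J + k); have := T_le (J + k)%N.
have := fk_ge (J + k) (x (J + k)); have := error_le (J + k) (Kx (J + k)).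
rewrite ler_norml => /andP[+ _]; lra.
Qed.

(* [fr] is not assumed continuous: it is compared with the continuous [fk J]
   for a fixed [J] with [T J] small. *)
Lemma cluster_minimizer : exists2 xs : 'cV[R]_n,
  cluster (x @ \oo) xs & K xs /\ forall y, K y -> fr xs <= fr y.
Proof.
have /choice[phi phiP] : forall j, exists k,
    (j <= k)%N /\ dotv (p k) (p k) < (j.+1%:R)^-1 :> R.
  by move=> j; have [|k ? ?] := @direction_small (j.+1%:R^-1) j; [|exists k].
have [xs [Kxs cl]] : K `&` cluster (x \o phi @ \oo) !=set0.
  by apply: compactK; exists 0%N => // j _; exact: Kx.
exists xs.
  by apply: cluster_subsequence cl => j; have [] := phiP j.
split=> // y Ky; apply/ler_addgt0Pr => e0 e0_gt0.
(* Six losses of at most [e] separate [fr xs] from [fr y]: [T J] twice, [T k] twice, the continuity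
   of [fk J] at [xs], and the subgradient term. *)
pose e := e0 / 6; have e_gt0 : 0 < e by rewrite divr_gt0.
have [J JT] := bounded_series_terms_small error_ge0 T_bounded e_gt0.
pose V := dotv (y - xs) (y - xs) + 1.
have V_gt0 : 0 < V by rewrite ltr_wpDl// dotv_ge0.
(* Young's inequality with weight [s] bounds [2 * dotv (g k) (y - x k)] below by
   [- (s * dotv (g k) (g k) + V / s)]. Here [V / s] is [e], and [j >= L] will make the other term at
   most [e]. *)
pose s := V / e; have s_gt0 : 0 < s by rewrite divr_gt0.
have sV : V / s = e by rewrite /s; field; rewrite !gt_eqF.
have [L /= pL] : exists L : nat, s * c / e < L.+1%:R.
  exists (Num.trunc (s * c / e)); exact: truncnS_gt.
pose U := [set u | fk J xs - e < fk J u] `&`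
  [set u : 'cV[R]_n | dotv (y - u) (y - u) < V].
have Uxs : nbhs xs U.
  apply: filterI.
    by apply: (cvgr_gt _ (@fk_continuous J xs)); rewrite ltrBlDr ltrDl.
  by apply: (cvgr_lt _ (@continuous_sqdist _ _ y xs)); rewrite ltrDl.
have [j Jj [/= fU VU]] := cluster_frequently (maxn J L) cl Uxs.
have [jk pk] := phiP j; set k := phi j in jk pk fU VU.
have Jk : (J <= k)%N.
  by apply: leq_trans jk; apply: leq_trans Jj; exact: leq_maxl.
have Tk := JT _ Jk; have TJ := JT _ (leqnn J).
have gs : s * dotv (g k) (g k) <= e.
  have Lj : L.+1%:R <= j.+1%:R :> R.
    by rewrite ler_nat ltnS; apply: leq_trans Jj; exact: leq_maxr.
  have : s * c / e * dotv (p k) (p k) <= 1.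
    apply: (@le_trans _ _ (j.+1%:R * j.+1%:R^-1)); last by rewrite divff.
    rewrite ler_pM ?dotv_ge0 ?(ltW pk) ?(ltW (lt_le_trans pL Lj))//.
    by rewrite !mulr_ge0 ?invr_ge0 ?ltW.
  rewrite mulrAC ler_pdivrMr// mul1r => h; apply: le_trans h.
  by rewrite -(mulrA s c); apply: ler_wpM2l; [exact: ltW|exact: g_le].
have gy : - e <= dotv (g k) (y - x k).
  have h := dotv_young s (g k) (y - x k).
  have : s * (2 * dotv (g k) (y - x k)) >= s * (- (e + V / s)).
    have -> : s * - (e + V / s) = - s * e - V by field; rewrite gt_eqF.
    have := ler_wpM2l (ltW s_gt0) gs; lra.
  by rewrite ler_pM2l// sV; lra.
have := g_subgrad k y; have := error_le k Ky; have := error_le k (Kx k).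
have := error_le J Kxs; have := error_le J (Kx k).
rewrite !ler_norml => /andP[? ?] /andP[? ?] /andP[? ?] /andP[? ?] ?.
have e6 : e0 = 6 * e by rewrite /e; field.
rewrite e6; move: fU => /= fU; lra.
Qed.

End deterministic_convergence.

(** * Partial sums of nonnegative series *)

Lemma nneseries_pinfty_unbounded (R : realType) (u : nat -> R) :
  (forall k, 0 <= u k) -> (\sum_(0 <= k <oo) (u k)%:E = +oo)%E ->
  forall A, exists k, A < \sum_(0 <= i < k) u i.
Proof.
move=> u0 uoo A; apply: contrapT => /forallNP nex.
have : (\sum_(0 <= k <oo) (u k)%:E <= A%:E)%E.
  apply: lime_le; first by apply: is_cvg_nneseries => k _ _; rewrite lee_fin.
  apply: nearW => k; rewrite sumEFin lee_fin leNgt; apply/negP; exact: nex.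
by rewrite uoo leye_eq.
Qed.

Lemma nneseries_partial_le (R : realType) (u : nat -> R) (A : R) :
  (forall k, 0 <= u k) -> (\sum_(0 <= k <oo) (u k)%:E <= A%:E)%E ->
  forall k, \sum_(0 <= i < k) u i <= A.
Proof.
move=> u0 uA k; rewrite -lee_fin -sumEFin; apply: le_trans uA.
by apply: nneseries_lim_ge => i _ _; rewrite lee_fin.
Qed.

Lemma nneseries_lty_fine (R : realType) (u : nat -> \bar R) :
  (forall k, 0 <= u k)%E -> (\sum_(0 <= k <oo) u k < +oo)%E ->
  (forall k, u k \is a fin_num) /\
  exists M, forall k, \sum_(0 <= i < k) fine (u i) <= M.
Proof.
move=> u0 uoo.
have ufin k : u k \is a fin_num.
  rewrite ge0_fin_numE//; apply: le_lt_trans uoo.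
  apply: le_trans (nneseries_lim_ge k.+1 _); last by move=> i _ _; exact: u0.
  by rewrite big_nat_recr//= leeDr// sume_ge0.
split=> //; exists (fine (\sum_(0 <= k <oo) u k)).
apply: nneseries_partial_le => [k|]; first by rewrite fine_ge0.
rewrite fineK ?ge0_fin_numE ?nneseries_ge0//.
by under eq_eseriesr do rewrite fineK//.
Qed.

(** * SAA functions, descent directions and the SAA error *)

Lemma saa_le (R : realType) (n m : nat) (F : 'cV[R]_n -> 'cV[R]_m -> R)
    (N : nat) (z : nat -> 'cV[R]_m) (y : 'cV[R]_n) (c : R) :
  (0 < N)%N -> (forall v, F y v <= c) -> saa F N z y <= c.
Proof.
move=> N0 Fc; rewrite /saa mulrC ler_pdivrMr ?ltr0n//.
rewrite mulr_natr -[X in _ *+ X](card_ord N) -sumr_const.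
by apply: ler_sum => i _; exact: Fc.
Qed.

Lemma saa_ge (R : realType) (n m : nat) (F : 'cV[R]_n -> 'cV[R]_m -> R)
    (N : nat) (z : nat -> 'cV[R]_m) (y : 'cV[R]_n) (c : R) :
  (0 < N)%N -> (forall v, c <= F y v) -> c <= saa F N z y.
Proof.
move=> N0 Fc; rewrite /saa mulrC ler_pdivlMr ?ltr0n//.
rewrite mulr_natr -[X in _ *+ X](card_ord N) -sumr_const.
by apply: ler_sum => i _; exact: Fc.
Qed.

Lemma saa_continuous (R : realType) (n m : nat)
    (F : 'cV[R]_n -> 'cV[R]_m -> R) (N : nat) (z : nat -> 'cV[R]_m) :
  (forall v, continuous (F ^~ v)) -> continuous (saa F N z).
Proof.
move=> cF; have cS : continuous (fun y => \sum_(i < N) F y (z i)).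
  by apply: continuous_big => [|i _]; [exact: add_continuous|exact: cF].
move=> y; apply: (@continuousM _ _ (fun=> N%:R^-1) _ y); last exact: cS.
exact: cst_continuous.
Qed.

(* [a |g|^2 <= <g, B g> = - <g, p>], and Young's inequality with [s = a]
   absorbs the right-hand side. *)
Lemma descent_direction_subgrad (R : realType) (n : nat) (a b : R)
    (B : 'M[R]_n) (phi : 'cV[R]_n -> R) (x p : 'cV[R]_n) :
  0 < a -> loewner_between a b B -> descent_direction a B phi x p ->
  exists g, subdifferential phi x g /\ dotv g g <= a ^- 2 * dotv p p.
Proof.
move=> a0 [_ aB] [g [sg -> _]]; exists g; split=> //.
have /andP[gB _] := aB g; have := dotv_young a g (- (B *m g)).
rewrite (dotvN g) (mulrC (a ^- 2)) ler_pdivlMr ?exprn_gt0//.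
have := ler_wpM2l (ltW a0) gB; lra.
Qed.

Lemma saa_error_le (R : realType) (n : nat) (f : 'cV[R]_n -> \bar R)
    (K : set 'cV[R]_n) (fN ftN : 'cV[R]_n -> R) (u v : 'cV[R]_n) :
  K u -> K v ->
  (`|f u - (fN u)%:E| + `|f v - (ftN v)%:E| <= saa_error f K fN ftN)%E.
Proof. by move=> Ku Kv; apply: ereal_sup_ubound; exists (u, v). Qed.

(** An infinite value of [f] on [K] would make the supremum infinite. Finiteness of the objective
    near the iterates is thus drawn from the summability of the errors. *)
Lemma saa_error_fine_le (R : realType) (n : nat) (f : 'cV[R]_n -> \bar R)
    (K : set 'cV[R]_n) (fN ftN : 'cV[R]_n -> R) (u v : 'cV[R]_n) :
  K u -> K v -> saa_error f K fN ftN \is a fin_num ->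
  [/\ f u \is a fin_num, f v \is a fin_num &
   `|fine (f u) - fN u| + `|fine (f v) - ftN v|
     <= fine (saa_error f K fN ftN)].
Proof.
move=> Ku Kv tfin; have := saa_error_le f fN ftN Ku Kv.
rewrite -(fineK tfin).
by case: (f u) => [r||]; case: (f v) => [s||]//=.
Qed.

(** * Growth of the SAA values along the algorithm *)

Section algorithm.
Context (R : realType) (n : nat) (h : nat -> R) (x0 : 'cV[R]_n) (N0 : nat).
Context (theta0 r beta gamma gammabar a b : R).
Context (fN ftN : nat -> 'cV[R]_n -> R) (N Nt : nat -> nat).
Context (theta alpha : nat -> R) (x p : nat -> 'cV[R]_n).
Hypothesis algo : IR_NS h x0 N0 theta0 r beta gamma gammabar a b fN ftN N Nt
  theta alpha x p.

(** Two moves alternate: changing the sample at [x k] costs at most [beta * h (N k)] by (R), and the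
    step to [x k.+1] costs nothing by (i). *)
Lemma IR_NS_saa_le (C0 : R) : 0 < gamma -> fN 0 x0 <= C0 ->
  forall k, ftN k.+1 (x k) <= C0 + beta * \sum_(0 <= i < k.+1) h (N i).
Proof.
move=> gamma0 f0.
have R_step k : ftN k.+1 (x k) <= fN k (x k) + beta * h (N k).
  by have [_ _] := S1 algo k; rewrite /condR lerBlDl.
have descent k : fN k.+1 (x k.+1) <= ftN k.+1 (x k).
  have := S3_i algo k; rewrite -(S4 algo k).
  have [_ _ /andP[/ltW alpha0 _]] := S3_choice algo k.
  have := mulr_ge0 (mulr_ge0 (ltW gamma0) alpha0) (dotv_ge0 (p k)); lra.
have fN_le k : fN k (x k) <= C0 + beta * \sum_(0 <= i < k) h (N i).
  elim: k => [|k IH].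
    by have [-> _ _] := S0 algo; rewrite big_geq// mulr0 addr0.
  rewrite big_nat_recr//= mulrDr.
  by have := descent k; have := R_step k; move: IH; lra.
move=> k; rewrite big_nat_recr//= mulrDr.
by have := fN_le k; have := R_step k; lra.
Qed.

End algorithm.

(** * From almost sure bounds to a minimizer on almost every path *)

Theorem theorem3p3 (R : realType) (n m : nat)
  (d : measure_display) (Omega : measurableType d) (P : probability Omega R)
  (* the problem *)
  (F : 'cV[R]_n -> 'cV[R]_m -> R) (xi : Omega -> 'cV[R]_m)
  (hxi : random_vector xi)
  (hF : forall x, borel_fun (F x))
  (h : nat -> R) (h_ge0 : forall N, 0 <= h N)
  (h_decr : nonincreasing_seq h) (h_cvg : h @ \oo --> (0 : R))
  (* parameters of the algorithm *)
  (x0 : 'cV[R]_n) (N0 : nat) (theta0 r beta gamma gammabar a b : R)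
  (hN0 : (0 < N0)%N) (htheta0 : 0 < theta0 < 1) (hr : 0 < r < 1)
  (hbeta : 0 < beta) (hgamma : 0 < gamma) (hgammabar : 0 < gammabar)
  (ha : 0 < a) (hab : a <= b)
  (* the samples drawn for f_(N_k) and f_(Ntilde_k) *)
  (z zt : nat -> nat -> Omega -> 'cV[R]_m)
  (hz : forall k, iid_sample P xi (z k))
  (hzt : forall k, iid_sample P xi (zt k.+1))
  (* the generated sequences *)
  (N Nt : nat -> Omega -> nat) (theta alpha : nat -> Omega -> R)
  (x p : nat -> Omega -> 'cV[R]_n)
  (hx : forall k, random_vector (x k)) :
  let f := objective P F xi in
  let fN k w := saa F (N k w) (fun i => z k i w) in
  let ftN k w := saa F (Nt k w) (fun i => zt k i w) in
  forall
  (hIRNS : {ae P, forall w,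
     IR_NS h x0 N0 theta0 r beta gamma gammabar a b (fN ^~ w) (ftN ^~ w)
       (N ^~ w) (Nt ^~ w) (theta ^~ w) (alpha ^~ w) (x ^~ w) (p ^~ w)})
  (hcondt : forall k, is_cond_expectation P (sigma_gen x k)
     (fun w => (ftN k.+1 w (x k w))%:E) (fun w => f (x k w)))
  (hcond : forall k, is_cond_expectation P (sigma_gen x k)
     (fun w => (fN k.+1 w (x k w))%:E) (fun w => f (x k w)))
  (* assumptions *)
  (C C0 C1 : R)
  (hA1 : assumption_A1 F C)
  (hA2 : assumption_A2 F a b)
  (hA3 : {ae P, forall w, forall k,
     condR h beta (fN k w) (ftN k.+1 w) (N k w) (x k w)})
  (hA4 : bounded_level_sets f)
  (hC0 : forall v, F x0 v <= C0)
  (hC1_gt0 : 0 < C1)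
  (hC1 : {ae P, forall w, (\sum_(0 <= k <oo) (h (N k w))%:E <= C1%:E)%E})
  (D0 : set 'cV[R]_n)
  (D0_open : open D0) (D0_bounded : bounded_set D0)
  (hD : [set y | (f y <= (C0 + 2 * beta * C1)%:E)%E] `<=` D0)
  (hA5 : dominated_on P F xi D0),
  let t k w := saa_error f (closure D0) (fN k.+1 w) (ftN k.+1 w) in
  {ae P, forall w,
     (\sum_(0 <= k <oo) (alpha k w)%:E = +oo)%E ->
     (\sum_(0 <= k <oo) t k w < +oo)%E ->
     exists2 xstar : 'cV[R]_n,
       cluster (x ^~ w @ \oo) xstar & forall y, (f xstar <= f y)%E}.
Proof.
move=> f fN ftN hIRNS hcondt hcond C C0 C1 hA1 hA2 hA3 hA4 hC0 hC1_gt0 hC1.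
move=> D0 D0_open D0_bounded hD hA5 t.
have /andP[r_gt0 _] := hr.
have C2_ge : C0 + beta * C1 <= C0 + 2 * beta * C1.
  by have := mulr_gt0 hbeta hC1_gt0; lra.
(* The exceptional null set depends on [k]; countably many are merged, so that one path satisfies
   all the bounds. *)
have f_iterates : {ae P, forall w k, (f (x k w) <= (C0 + beta * C1)%:E)%E}.
  apply: ae_foralln => k; apply: cond_expectation_le (hcondt k) _.
  apply: filterS2 hIRNS hC1 => w algo hC1w; rewrite lee_fin.
  apply: le_trans (IR_NS_saa_le algo hgamma (C0 := C0) _ k) _.
    by apply: saa_le => //; have [_ -> _] := S0 algo.
  by rewrite lerD2l ler_pM2l//; exact: nneseries_partial_le.
apply: filterS2 hIRNS f_iterates => w algo fx alpha_oo t_lty.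
have Dx k : closure D0 (x k w).
  apply: subset_closure; apply: hD; apply: le_trans (fx k) _.
  by rewrite lee_fin.
have t_ge0 k : (0 <= t k w)%E.
  by apply: le_trans (saa_error_le _ _ _ (Dx 0) (Dx 0)); rewrite adde_ge0.
have [t_fin [M t_M]] := nneseries_lty_fine t_ge0 t_lty.
have N_gt0 k : (0 < N k w)%N.
  case: k => [|k]; first by have [_ -> _] := S0 algo.
  by have [/andP[]] := S3_choice algo k.
have alpha_ge0 k : 0 <= alpha k w.
  by have [_ _ /andP[/ltW]] := S3_choice algo k.
have /choice[g gP] : forall k, exists g,
    subdifferential (fN k.+1 w) (x k w) g /\
    dotv g g <= a ^- 2 * dotv (p k w) (p k w).
  move=> k; have [_ [B aBb dB] _] := S3_choice algo k.
  exact: descent_direction_subgrad aBb dB.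
have f_fin u : closure D0 u -> f u \is a fin_num.
  by move=> Du; have [] := saa_error_fine_le Du Du (t_fin 0%N).
have [xs cl [Dxs xs_min]] : exists2 xs : 'cV[R]_n,
    cluster (x ^~ w @ \oo) xs & closure D0 xs /\
    forall y, closure D0 y -> fine (f xs) <= fine (f y).
  (* Index [k] there stands for the functions of index [k.+1] here, built in the step from [x k] to
     [x k.+1]. *)
  apply: (@cluster_minimizer _ _ _ (fine \o f) (fun k => fN k.+1 w)
    (fun k => ftN k.+1 w) (x ^~ w) (p ^~ w) g (alpha ^~ w)
    (fun k => fine (t k w)) gamma (a ^- 2) C M) => //.
  - by rewrite invr_gt0 exprn_gt0.
  - apply: bounded_closed_compact_cV; last exact: closed_closure.
    exact: bounded_closure.
  - by move=> k u v Du Dv; have [] := saa_error_fine_le Du Dv (t_fin k).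
  - exact: nneseries_pinfty_unbounded.
  - by move=> k; apply: saa_continuous => v; have [] := hA1 v.
  - by move=> k u; apply: saa_ge => // v; have [] := hA1 v.
  - by move=> k; have [] := gP k.
  - by move=> k; have [] := gP k.
  - by move=> k; rewrite (S4 algo k); exact: (S3_i algo k).
exists xs => // y; have [Dy|nDy] := pselect (closure D0 y).
  by rewrite -(fineK (f_fin _ Dxs)) -(fineK (f_fin _ Dy)) lee_fin xs_min.
(* Off [closure D0], [f y] may be infinite, so the comparison passes through the finite value at the
   first iterate. *)
apply: (@le_trans _ _ (f (x 0%N w))).
  by rewrite -(fineK (f_fin _ Dxs)) -(fineK (f_fin _ (Dx _))) lee_fin xs_min.
apply: le_trans (fx 0%N) _; rewrite leNgt; apply/negP => fy.
apply: nDy; apply: subset_closure; apply: hD; apply: le_trans (ltW fy) _.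
by rewrite lee_fin.
Qed.
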